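(* Let $n$ be a positive odd integer. Then $$\sum_{k=0}^{n-1}(-1)^k \frac{(q;q^2)_k(-q;q^2)_k^2}{(q^4;q^4)_k(-q^4;q^4)_k^2}[6k+1]q^{3k^2} \equiv 0\pmod{[n]}$$ and $$\sum_{k=0}^{(n-1)/2}(-1)^k\frac{(q;q^2)_k(-q;q^2)_k^2}{(q^4;q^4)_k(-q^4;q^4)_k^2}[6k+1]q^{3k^2} \equiv 0\pmod{[n]}.$$
   Context: Here $q$ is an indeterminate, $(x;y)_k=\prod_{j=0}^{k-1}(1-xy^j)$ (with $(x;y)_0=1$), and $[k]=\frac{1-q^k}{1-q}$. For rational functions $A(q),B(q)\in\mathbb Z(q)$ and a polynomial $P(q)\in\mathbb Z[q]$, the congruence $A(q)\equiv B(q)\pmod{P(q)}$ means that $A(q)-B(q)=A_1(q)/A_2(q)$ with $A_1,A_2\in\mathbb Z[q]$, where $P$ divides $A_1$ and $P$ is coprime with $A_2$. *)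

(* Defs.v *)
From HB Require Import structures.
From mathcomp Require Export all_boot all_order all_algebra.

Set Implicit Arguments.
Unset Strict Implicit.
Unset Printing Implicit Defensive.

Import GRing.Theory.

Local Open Scope ring_scope.

Notation Zq := {fraction {poly int}}.

Definition qvar : Zq := tofrac ('X : {poly int}).

Definition qpoch (x y : Zq) (k : nat) : Zq := \prod_(j < k) (1 - x * y ^+ j).

Definition qint (k : nat) : Zq := (1 - qvar ^+ k) / (1 - qvar).

(* [qint n] as an element of Z[q], needed when it serves as a modulus.  The
   leading coefficient of [1 - 'X] is a unit, so that [%/] is here the genuine
   Euclidean quotient and not a pseudo-quotient; see [tofrac_qint_poly]. *)
Definition qint_poly (n : nat) : {poly int} := (1 - 'X^n) %/ (1 - 'X).

(* Divisibility in the ring Z[q] itself.  On {poly int}, the relation [%|] and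
   the predicate [coprimep] are insensitive to nonzero integer factors, that is,
   they are divisibility and coprimality in Q[q]. *)
Definition Zdvd (P A : {poly int}) : Prop := exists C : {poly int}, A = C * P.

Definition Zcoprime (P A : {poly int}) : Prop :=
  forall D : {poly int}, Zdvd D P -> Zdvd D A -> D \is a GRing.unit.

Definition qcongr (A B : Zq) (P : {poly int}) : Prop :=
  exists A1 A2 : {poly int},
    [/\ A2 != 0, A - B = tofrac A1 / tofrac A2, Zdvd P A1 & Zcoprime P A2].

Definition qterm (k : nat) : Zq :=
  (-1) ^+ k
  * (qpoch qvar (qvar ^+ 2) k * qpoch (- qvar) (qvar ^+ 2) k ^+ 2
     / (qpoch (qvar ^+ 4) (qvar ^+ 4) k * qpoch (- qvar ^+ 4) (qvar ^+ 4) k ^+ 2))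
  * qint (6 * k + 1) * qvar ^+ (3 * k ^ 2).

Lemma qint_polyE (n : nat) : qint_poly n = \sum_(i < n) 'X^i.
Proof.
rewrite /qint_poly -[X in (X - _) %/ _](expr1n _ n) subrXX.
under eq_bigr do rewrite expr1n mul1r.
have lcE : lead_coef (1 - 'X : {poly int}) = -1.
  by rewrite -opprB lead_coefN -[1]/(1%:P) lead_coefXsubC.
by rewrite mulrC Pdiv.IdomainUnit.mulpK // lcE unitrN1.
Qed.

Lemma tofrac_qint_poly (n : nat) : tofrac (qint_poly n) = qint n.
Proof.
have q1 : 1 - qvar != 0.
  rewrite /qvar -tofrac1 -tofracB tofrac_eq0 -opprB oppr_eq0 -[1]/(1%:P).
  exact: (monic_neq0 (monicXsubC 1)).
apply: (mulIf q1); rewrite /qint mulfVK //.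
rewrite /qvar -tofrac1 -tofracXn -!tofracB -tofracM; congr tofrac.
rewrite qint_polyE -[X in _ = X - _](expr1n _ n) subrXX mulrC.
by under [in RHS]eq_bigr do rewrite expr1n mul1r.
Qed.

(* Main.v *)
Require Import Defs.
From mathcomp Require Import all_boot all_order all_algebra all_field.
From mathcomp Require Import ring zify.

(** Write the summand as c_k [6k+1].  A rational function of q is divisible by
[n] as soon as it is regular at every n-th root of unity and vanishes at those
other than 1, because [n] is monic with simple roots ([Zdvd_qint],
[Zcoprime_qint]).  So everything is evaluated at a root of unity z <> 1, say of
exact order d; d divides n, hence is odd.

Regularity: (q;q^2)_k / (q^2;q^2)_k is a central Gaussian binomial divided by
(-q;q)_k^2, so c_k has a denominator made of factors 1 + q^i only
([qterm_frac]), and these never vanish at a root of unity of odd order.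

Periodicity: the ratio c_(k+1) / c_k is a rational function of z^k, hence
d-periodic in k wherever it has no pole, and c_(md+r) = c_(md) w_r for
0 <= r < d, where w_r does not depend on m ([coef_at_block]).  Cut into blocks of length d, the complete sum consists of
full blocks, and the sum up to (n-1)/2 of full blocks followed by a block of
length (d+1)/2.  It remains to see that
  w_0 (1 - z) + w_1 (1 - z^7) + ... + w_M (1 - z^(6M+1)) = 0
whenever (d-1)/2 <= M < d.

This is a case of a terminating sum over an arbitrary field.  With p = bc and
  w_k = (a;p)_k (b;p)_k (c;p)_k (-a)^k p^(k(3k-1)/2)
        / ((p^2;p^2)_k (abp;p^2)_k (acp;p^2)_k),
the sum of (1 - a p^(3k)) w_k over 0 <= k <= M is 0 as soon as a p^N = 1 for
some N <= M ([vwp_sum_eq0]).  It is a limiting case of a quadratic summation of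
Gasper and Rahman; the value of the infinite sum is
  (a;p)_oo / ((abp;p^2)_oo (acp;p^2)_oo).
That product suggests relating the sums S(a) and S(a p^2):
  (1 - abp) (1 - acp) S(a) - (1 - a) (1 - ap) S(a p^2)
telescopes, with a boundary term killed by (a;p)_(M+1) ([vwp_sum_contiguous]).
Each step lowers N by 2, and at N = 0 or 1 the factor (1 - a) (1 - ap) is 0.
At a root z of order d one takes b = c = -z, p = z^2 and a = z, and
a p^((d-1)/2) = z^d = 1. *)

Set Implicit Arguments.
Unset Strict Implicit.
Unset Printing Implicit Defensive.

Import GRing.Theory Num.Theory.
Local Open Scope ring_scope.

(** * A terminating quadratic summation *)

Definition vwp_ratio (F : fieldType) (b c a y : F) : F :=
  - a * (b * c) * y ^+ 3 * ((1 - a * y) * (1 - b * y) * (1 - c * y))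
  / ((1 - (b * c * y) ^+ 2) * (1 - a * b * (b * c) * y ^+ 2)
     * (1 - a * c * (b * c) * y ^+ 2)).

(** The products are kept as products of term ratios, so that the base p = b c
enters only through its powers, without the halving in k(3k-1)/2 or the
quotient p / b of the classical form. *)
Definition vwp_coef (F : fieldType) (b c a : F) (k : nat) : F :=
  \prod_(j < k) vwp_ratio b c a ((b * c) ^+ j).

Definition vwp_regular (F : fieldType) (b c a : F) : Prop :=
  forall j, 1 - a * b * (b * c) * ((b * c) ^+ j) ^+ 2 != 0
         /\ 1 - a * c * (b * c) * ((b * c) ^+ j) ^+ 2 != 0.

Lemma vwp_coefS (F : fieldType) (b c a : F) k :
  vwp_coef b c a k.+1 = vwp_coef b c a k * vwp_ratio b c a ((b * c) ^+ k).
Proof. by rewrite /vwp_coef big_ord_recr. Qed.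

Lemma vwp_coef0 (F : fieldType) (b c a : F) : vwp_coef b c a 0 = 1.
Proof. by rewrite /vwp_coef big_ord0. Qed.

Lemma vwp_regular_shift (F : fieldType) (b c a : F) :
  vwp_regular b c a -> vwp_regular b c (a * (b * c) ^+ 2).
Proof.
move=> reg j; have [] := reg j.+1; rewrite (exprS _ j) => ab ac.
by split; [move: ab | move: ac]; congr (_ != 0); ring.
Qed.

(** The shift a -> a p^2 moves two factors at each end of (a;p)_k and one at
each end of the two Pochhammer symbols in base p^2; every other change is a
power of p. *)
Lemma vwp_coef_contiguous (F : fieldType) (b c a : F) k :
  vwp_regular b c a ->
  (forall j, (j < k)%N -> 1 - (b * c * (b * c) ^+ j) ^+ 2 != 0) ->
  (1 - a) * (1 - a * (b * c)) * vwp_coef b c (a * (b * c) ^+ 2) k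
    * ((1 - a * b * (b * c) * ((b * c) ^+ k) ^+ 2)
       * (1 - a * c * (b * c) * ((b * c) ^+ k) ^+ 2))
  = (1 - a * b * (b * c)) * (1 - a * c * (b * c)) * vwp_coef b c a k
    * ((1 - a * (b * c) ^+ k) * (1 - a * (b * c) * (b * c) ^+ k)
       * ((b * c) ^+ k) ^+ 2).
Proof.
move=> reg; elim: k => [|k IH] p_neq1.
  by rewrite !vwp_coef0 !expr0; ring.
have {}IH := IH (fun j jk => p_neq1 j (ltnW jk)).
have py_neq1 := p_neq1 k (ltnSn k).
have [aby_neq1 acy_neq1] := reg k; have := reg k.+1.
move: IH py_neq1 aby_neq1 acy_neq1; rewrite !vwp_coefS !(exprS _ k) /vwp_ratio.
set V := vwp_coef b c a k; set W := vwp_coef _ _ _ k; set y := (b * c) ^+ k.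
move=> IH py_neq1 aby_neq1 acy_neq1 [abpy_neq1 acpy_neq1].
have den_neq0 := mulf_neq0 aby_neq1 acy_neq1.
have {}IH := canRL (mulfK den_neq0) IH.
rewrite !(mulrA _ W) IH.
field; rewrite aby_neq1 acy_neq1 py_neq1 /=.
have -> : a * (b * c) ^+ 2 * c * (b * c) * y ^+ 2
          = a * c * (b * c) * (b * c * y) ^+ 2 by ring.
have -> : a * (b * c) ^+ 2 * b * (b * c) * y ^+ 2
          = a * b * (b * c) * (b * c * y) ^+ 2 by ring.
by rewrite acpy_neq1.
Qed.

(** The summand of the left-hand side is G(k+1) - G(k), G(0) = 0, where G(k) is
    - (1 - p^(2k)) (1 - ab p^(2k+1)) (1 - ac p^(2k+1)) C_k
and C_k is [vwp_coef b c a k] with its denominators (abp;p^2)_k, (acp;p^2)_k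
replaced by (abp^3;p^2)_k, (acp^3;p^2)_k.  The right-hand side is G(M+1),
rewritten with the coefficient of index M so that 1 - p^(2M+2) need not be
invertible. *)
Lemma vwp_sum_contiguous (F : fieldType) (b c a : F) M :
  vwp_regular b c a ->
  (forall j, (j < M)%N -> 1 - (b * c * (b * c) ^+ j) ^+ 2 != 0) ->
  (1 - a * b * (b * c)) * (1 - a * c * (b * c))
    * \sum_(0 <= k < M.+1) (1 - a * ((b * c) ^+ k) ^+ 3) * vwp_coef b c a k
  - (1 - a) * (1 - a * (b * c))
    * \sum_(0 <= k < M.+1) (1 - a * (b * c) ^+ 2 * ((b * c) ^+ k) ^+ 3)
                          * vwp_coef b c (a * (b * c) ^+ 2) k
  = (1 - a * b * (b * c)) * (1 - a * c * (b * c)) * vwp_coef b c a M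
    * (a * (b * c) * ((b * c) ^+ M) ^+ 3)
    * ((1 - a * (b * c) ^+ M) * (1 - b * (b * c) ^+ M) * (1 - c * (b * c) ^+ M))
    / ((1 - a * b * (b * c) * ((b * c) ^+ M) ^+ 2)
       * (1 - a * c * (b * c) * ((b * c) ^+ M) ^+ 2)).
Proof.
move=> reg; elim: M => [|M IH] p_neq1.
  rewrite !big_nat1 !vwp_coef0 !expr0; have [] := reg 0.
  rewrite expr0 !expr1n !mulr1.
  by move=> ab ac; field; rewrite ab ac.
have {}IH := IH (fun j jk => p_neq1 j (ltnW jk)).
have py_neq1 := p_neq1 M (ltnSn M).
have cont := vwp_coef_contiguous reg p_neq1.
have [aby_neq1 acy_neq1] := reg M; have := reg M.+1.
rewrite big_nat_recr //= (big_nat_recr M.+1) //=.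
have split_last A B S S' x y :
  A * (S + x) - B * (S' + y) = A * S - B * S' + (A * x - B * y) :> F by ring.
rewrite split_last IH {split_last IH}.
move: cont py_neq1 aby_neq1 acy_neq1.
rewrite [vwp_coef b c a M.+1]vwp_coefS !(exprS _ M) /vwp_ratio.
set V := vwp_coef b c a M; set W := vwp_coef _ _ _ M.+1; set y := (b * c) ^+ M.
move=> cont py_neq1 aby_neq1 acy_neq1 [abpy_neq1 acpy_neq1].
have {}cont := canRL (mulfK (mulf_neq0 abpy_neq1 acpy_neq1)) cont.
rewrite (mulrC _ W) !(mulrA _ W) cont.
by field; rewrite aby_neq1 acy_neq1 py_neq1 abpy_neq1 acpy_neq1.
Qed.

Lemma vwp_coef_eq0 (F : fieldType) (b c a : F) N k :
  a * (b * c) ^+ N = 1 -> (N < k)%N -> vwp_coef b c a k = 0.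
Proof.
move=> aN Nk; rewrite /vwp_coef (bigD1 (Ordinal Nk)) //= /vwp_ratio aN subrr.
by rewrite !(mul0r, mulr0).
Qed.

(** The bound M is fixed while N decreases: terms beyond the natural end of the
sum are 0, so that one truncation serves all the shifted sums. *)
Theorem vwp_sum_eq0 (F : fieldType) (b c a : F) N M :
  (N <= M)%N -> a * (b * c) ^+ N = 1 -> vwp_regular b c a ->
  (forall j, (j < M)%N -> 1 - (b * c * (b * c) ^+ j) ^+ 2 != 0) ->
  \sum_(0 <= k < M.+1) (1 - a * ((b * c) ^+ k) ^+ 3) * vwp_coef b c a k = 0.
Proof.
move=> NM aN reg p_neq1; elim/ltn_ind: N a NM aN reg => N IH a NM aN reg.
have := vwp_sum_contiguous reg p_neq1.
have /eqP -> : (1 - a * b * (b * c)) * (1 - a * c * (b * c)) * vwp_coef b c a M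
    * (a * (b * c) * ((b * c) ^+ M) ^+ 3)
    * ((1 - a * (b * c) ^+ M) * (1 - b * (b * c) ^+ M) * (1 - c * (b * c) ^+ M))
    / ((1 - a * b * (b * c) * ((b * c) ^+ M) ^+ 2)
       * (1 - a * c * (b * c) * ((b * c) ^+ M) ^+ 2)) == 0.
  move: NM; rewrite leq_eqVlt => /orP[/eqP <-|NM].
    by rewrite aN subrr !(mul0r, mulr0).
  by rewrite (vwp_coef_eq0 aN NM) !(mul0r, mulr0).
set S := \sum_(0 <= k < M.+1) (1 - a * _) * _; set S' := \sum_(_ <= _ < _) _.
have -> : (1 - a) * (1 - a * (b * c)) * S' = 0.
  (* a = 1, then a p = 1, then the induction hypothesis for a p^2 *)
  case: N IH NM aN => [|[|N]] IH NM aN.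
  - by rewrite -{1}aN expr0 mulr1 subrr !mul0r.
  - by rewrite -{2}aN expr1 subrr mulr0 mul0r.
  rewrite /S' (IH N) ?mulr0 //; first exact: ltnW (ltnW NM).
    by rewrite -mulrA -exprD add2n.
  exact: vwp_regular_shift.
move/eqP; rewrite subr0 !mulf_eq0; have [] := reg 0.
rewrite expr0 expr1n !mulr1 => /negPf -> /negPf -> /=; by move/eqP.
Qed.

(** * Gaussian binomials and the denominators of the summands *)

(** The same product as [qpoch], over any ring, so that it can be taken in Z[q],
in Z(q) and at a complex number. *)
Definition poch (R : comNzRingType) (x y : R) (k : nat) : R :=
  \prod_(j < k) (1 - x * y ^+ j).

Lemma poch0 (R : comNzRingType) (x y : R) : poch x y 0 = 1.
Proof. by rewrite /poch big_ord0. Qed.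

Lemma pochS (R : comNzRingType) (x y : R) k :
  poch x y k.+1 = poch x y k * (1 - x * y ^+ k).
Proof. by rewrite /poch big_ord_recr. Qed.

Lemma rmorph_poch (R S : comNzRingType) (f : {rmorphism R -> S}) (x y : R) k :
  f (poch x y k) = poch (f x) (f y) k.
Proof.
rewrite /poch rmorph_prod; apply: eq_bigr => j _.
by rewrite rmorphB rmorph1 rmorphM rmorphXn.
Qed.

Lemma poch_sqr (R : comNzRingType) (x y : R) k :
  poch (x ^+ 2) (y ^+ 2) k = poch x y k * poch (- x) y k.
Proof.
rewrite /poch -big_split; apply: eq_bigr => j _ /=.
by rewrite exprAC; ring.
Qed.

Lemma poch_double (R : comNzRingType) (x y : R) k :
  poch x y (k + k) = poch x (y ^+ 2) k * poch (x * y) (y ^+ 2) k.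
Proof.
elim: k => [|k IH]; first by rewrite !poch0 mulr1.
by rewrite addSn addnS !pochS IH -exprM mul2n -addnn (exprS y (k + k)); ring.
Qed.

Lemma poch_neq0 (R : idomainType) (x y : R) k :
  (forall j, (j < k)%N -> 1 - x * y ^+ j != 0) -> poch x y k != 0.
Proof. by move=> nz; apply/prodf_neq0 => j _; apply: nz. Qed.

(** The Gaussian binomial coefficient of m + k over k, by its Pascal rule: it is
a polynomial in x, which the quotient of Pochhammer symbols does not show. *)
Fixpoint gauss (R : comNzRingType) (x : R) (m : nat) {struct m} : nat -> R :=
  if m is m'.+1 then
    fix gauss_m k :=
      if k is k'.+1 then gauss x m' k + x ^+ m * gauss_m k' else 1
  else fun=> 1.

Lemma gauss_poch (R : comNzRingType) (x : R) m k :
  gauss x m k * poch x x m * poch x x k = poch x x (m + k).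
Proof.
elim: m k => [|m IHm] k; first by rewrite poch0 /= !mul1r.
elim: k => [|k IHk]; first by rewrite /= poch0 mul1r mulr1 addn0.
have -> : gauss x m.+1 k.+1 = gauss x m k.+1 + x ^+ m.+1 * gauss x m.+1 k by [].
have -> : (gauss x m k.+1 + x ^+ m.+1 * gauss x m.+1 k)
          * poch x x m.+1 * poch x x k.+1
  = (gauss x m k.+1 * poch x x m * poch x x k.+1) * (1 - x * x ^+ m)
    + x ^+ m.+1 * (gauss x m.+1 k * poch x x m.+1 * poch x x k)
      * (1 - x * x ^+ k).
  by rewrite !pochS; ring.
by rewrite IHm IHk !addSn !addnS !pochS !exprS exprD; ring.
Qed.

Lemma onesubX_neq0 (R : nzRingType) m : (1 - 'X^(m.+1) : {poly R}) != 0.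
Proof.
rewrite -opprB oppr_eq0; apply: monic_neq0; exact: monicXnsubC.
Qed.

Lemma pochX_neq0 k : poch ('X : {poly int}) 'X k != 0.
Proof. by apply: poch_neq0 => j _; rewrite -exprS onesubX_neq0. Qed.

Definition qcentral (k : nat) : {poly int} := gauss 'X k k.

Lemma qcentral_poch k :
  qcentral k * poch 'X 'X k = poch 'X ('X ^+ 2) k * poch (- 'X) 'X k.
Proof.
apply: (mulIf (pochX_neq0 k)); rewrite gauss_poch poch_double -expr2 poch_sqr.
by ring.
Qed.

(** Unlike the quotient of Pochhammer symbols, this relation survives evaluation
at a root of unity. *)
Lemma qcentralS k :
  qcentral k.+1 * (1 - 'X^(k.+1))
  = qcentral k * ((1 - 'X * ('X ^+ 2) ^+ k) * (1 + 'X^(k.+1))).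
Proof.
have := qcentral_poch k.+1; rewrite !pochS => eqS.
apply: (mulIf (pochX_neq0 k)); move: eqS; rewrite (exprS 'X k) => eqS.
have -> : qcentral k.+1 * (1 - 'X * 'X^k) * poch 'X 'X k
          = qcentral k.+1 * (poch 'X 'X k * (1 - 'X * 'X^k)) by ring.
rewrite eqS.
have := qcentral_poch k; set P := poch _ _ _ => eqk.
have -> (B C : {poly int}) :
  qcentral k * (B * C) * P = qcentral k * P * (B * C) by ring.
by rewrite eqk; ring.
Qed.

(** [coef_num k / coef_den k] is the summand without its factor [6k+1]. *)
Definition coef_num (k : nat) : {poly int} :=
  (-1) ^+ k * qcentral k * poch (- 'X) ('X ^+ 2) k ^+ 2 * 'X ^+ (3 * k ^ 2).

Definition coef_den (k : nat) : {poly int} :=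
  poch (- 'X) 'X k ^+ 2 * poch (- 'X ^+ 2) ('X ^+ 2) k
  * poch (- 'X ^+ 4) ('X ^+ 4) k ^+ 2.

Lemma onepX_neq0 m : (1 + 'X^(m.+1) : {poly int}) != 0.
Proof.
rewrite addrC -['X^(m.+1) + 1]/('X^(m.+1) + 1%:P).
exact: monic_neq0 (monicXnaddC _ _).
Qed.

Lemma pochNX_neq0 i k : poch (- 'X^(i.+1) : {poly int}) ('X^(i.+1)) k != 0.
Proof.
apply: poch_neq0 => j _; rewrite mulNr opprK -exprS -exprM mulnS addSn.
exact: onepX_neq0.
Qed.

Lemma coef_den_neq0 k : coef_den k != 0.
Proof.
have nz0 : poch (- 'X : {poly int}) 'X k != 0 := pochNX_neq0 0 k.
by rewrite /coef_den !mulf_neq0 ?(pochNX_neq0 1) ?(pochNX_neq0 3).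
Qed.

(** Each factor 1 - q^(4j) splits as (1 - q^j) (1 + q^j) (1 + q^(2j)); the part
(q;q)_k is absorbed by (q;q^2)_k through the central Gaussian binomial. *)
Lemma qterm_frac k :
  qterm k = tofrac (coef_num k * qint_poly (6 * k + 1)) / tofrac (coef_den k).
Proof.
pose f : {rmorphism {poly int} -> Zq} := @tofrac {poly int}.
have pochE (x y : {poly int}) i :
  qpoch (tofrac x) (tofrac y) i = tofrac (poch x y i).
  by rewrite -[RHS]/(f _) rmorph_poch.
have -> : qterm k = tofrac ((-1) ^+ k * (poch 'X ('X ^+ 2) k
    * poch (- 'X) ('X ^+ 2) k ^+ 2) * qint_poly (6 * k + 1) * 'X ^+ (3 * k ^ 2))
  / tofrac (poch ('X ^+ 4) ('X ^+ 4) k * poch (- 'X ^+ 4) ('X ^+ 4) k ^+ 2).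
  rewrite /qterm /qvar -!tofracXn -!tofracN !pochE -tofrac_qint_poly.
  rewrite !(tofracXn, tofracM, tofracN, tofrac1).
  by ring.
apply/eqP; rewrite eqr_div ?tofrac_eq0 ?coef_den_neq0 //; last first.
  rewrite mulf_neq0 ?expf_neq0 ?(pochNX_neq0 3) //.
  by apply: poch_neq0 => j _; rewrite -exprS -exprM mulnS addSn onesubX_neq0.
rewrite -!tofracM tofrac_eq /coef_num /coef_den.
have -> : poch ('X ^+ 4) ('X ^+ 4) k = poch 'X 'X k * poch (- 'X) 'X k
    * poch (- 'X ^+ 2) ('X ^+ 2) k :> {poly int}.
  by rewrite -!poch_sqr -!exprM.
apply/eqP; have := qcentral_poch k; set P := poch 'X 'X k.
set Q := poch (- 'X) 'X k => eqk.
set I := qint_poly _; set B := poch (- 'X) ('X ^+ 2) k.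
set C := poch (- 'X ^+ 2) _ _; set D := poch (- 'X ^+ 4) _ _.
have -> : (-1) ^+ k * qcentral k * B ^+ 2 * 'X^(3 * k ^ 2) * I
  * (P * Q * C * D ^+ 2) = (-1) ^+ k * B ^+ 2 * 'X^(3 * k ^ 2) * I
  * (Q * C * D ^+ 2) * (qcentral k * P) by ring.
by rewrite eqk; ring.
Qed.

(** * Evaluation at a root of unity of odd order *)

Definition evalC (z : algC) : {rmorphism {poly int} -> algC} :=
  horner_eval z \o map_poly intr.

Lemma evalCX (z : algC) : evalC z 'X = z.
Proof. by rewrite /evalC /= map_polyX horner_evalE hornerX. Qed.

Lemma evalC_qint (z : algC) m : (1 - z) * evalC z (qint_poly m) = 1 - z ^+ m.
Proof.
rewrite qint_polyE rmorph_sum -[X in _ = X - _](expr1n _ m) subrXX.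
congr (_ * _); apply: eq_bigr => i _.
by rewrite rmorphXn evalCX expr1n mul1r.
Qed.

Definition coef_at (z : algC) (k : nat) : algC :=
  evalC z (coef_num k) / evalC z (coef_den k).

Lemma add1_root_neq0 (z : algC) n i : odd n -> z ^+ n = 1 -> 1 + z ^+ i != 0.
Proof.
move=> n_odd zn1; apply/negP => /eqP zi.
have zi1 : z ^+ i = -1 by apply/eqP; rewrite -addr_eq0 addrC zi.
have : (z ^+ i) ^+ n = 1 by rewrite exprAC zn1 expr1n.
rewrite zi1 -signr_odd n_odd expr1 => /eqP.
by rewrite -subr_eq0 -opprD oppr_eq0 -mulr2n pnatr_eq0.
Qed.

Lemma poch_root_neq0 (z : algC) n i k : odd n -> z ^+ n = 1 ->
  poch (- z ^+ i) (z ^+ i) k != 0.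
Proof.
move=> n_odd zn1; apply: poch_neq0 => j _.
by rewrite mulNr opprK -exprS -exprM (add1_root_neq0 _ n_odd zn1).
Qed.

Lemma evalC_coef_den (z : algC) k : evalC z (coef_den k) =
  poch (- z) z k ^+ 2 * poch (- z ^+ 2) (z ^+ 2) k
  * poch (- z ^+ 4) (z ^+ 4) k ^+ 2.
Proof.
by rewrite /coef_den !(rmorphM, rmorphXn, rmorph_poch, rmorphN) evalCX.
Qed.

Lemma evalC_coef_den_neq0 (z : algC) n k : odd n -> z ^+ n = 1 ->
  evalC z (coef_den k) != 0.
Proof.
move=> n_odd zn1; rewrite evalC_coef_den.
have nz i := poch_root_neq0 i k n_odd zn1.
have nz1 := nz 1%N; rewrite expr1 in nz1.
by rewrite !mulf_neq0.
Qed.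

Lemma evalC_coef_num (z : algC) k : evalC z (coef_num k) =
  (-1) ^+ k * evalC z (qcentral k) * poch (- z) (z ^+ 2) k ^+ 2
  * z ^+ (3 * k ^ 2).
Proof.
rewrite /coef_num; set g := qcentral k.
by rewrite !(rmorphM, rmorphXn, rmorph_poch, rmorphN, rmorph1) evalCX.
Qed.

Lemma evalC_qcentralS (z : algC) k :
  evalC z (qcentral k.+1) * (1 - z ^+ k.+1)
  = evalC z (qcentral k) * ((1 - z * (z ^+ 2) ^+ k) * (1 + z ^+ k.+1)).
Proof.
have := congr1 (evalC z) (qcentralS k).
move: (qcentral k.+1) (qcentral k) => g' g.
by rewrite !(rmorphM, rmorphB, rmorphD, rmorph1, rmorphXn) evalCX.
Qed.

(** When z^(k+1) = 1 the ratio has a zero denominator: this relation links the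
coefficients inside a block of indices, never across its ends. *)
Lemma coef_atS (z : algC) n k : odd n -> z ^+ n = 1 -> z ^+ k.+1 != 1 ->
  coef_at z k.+1 = coef_at z k * vwp_ratio (- z) (- z) z ((- z * - z) ^+ k).
Proof.
move=> n_odd zn1 zk1.
have nz i := add1_root_neq0 i n_odd zn1.
have nzk i := poch_root_neq0 i k n_odd zn1.
have nz1 := nzk 1%N; rewrite expr1 in nz1.
have := evalC_qcentralS z k.
rewrite /coef_at !evalC_coef_den !evalC_coef_num !pochS.
have -> : z ^+ (3 * k.+1 ^ 2) = z ^+ (3 * k ^ 2) * (z ^+ k) ^+ 6 * z ^+ 3.
  by rewrite -exprM -!exprD; congr (_ ^+ _); lia.
have -> : (- z * - z) ^+ k = (z ^+ k) ^+ 2 by rewrite mulrNN -expr2 exprAC.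
rewrite /vwp_ratio !(exprAC _ _ k) (exprS _ k).
have n1 := nz k.+1; have n2 := nz (k.+1 * 2)%N; have n4 := nz (k.+1 * 4)%N.
move: zk1 n1 n2 n4 (nzk 2) (nzk 4) nz1; rewrite !exprM !(exprS z k) -subr_eq0.
move: (evalC z (qcentral k)) (evalC z (qcentral k.+1)) (z ^+ k) => g g' y.
move: (poch _ _ _) (poch _ _ _) (poch _ _ _) (poch _ _ _) => P1 P2 P3 P4.
rewrite -oppr_eq0 opprB => zk1 n1 n2 n4 P2_neq0 P3_neq0 P1_neq0 eqg.
rewrite exprS (canRL (mulfK zk1) eqg).
field.
have -> : 1 - z * - z * (- z * - z) * y ^+ 4 = 1 + (z * y) ^+ 4 by ring.
have -> : 1 - (- z * - z * y ^+ 2) ^+ 2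
          = (1 - z * y) * (1 + z * y) * (1 + (z * y) ^+ 2) by ring.
have -> : 1 - - z ^+ 2 * y ^+ 2 = 1 + (z * y) ^+ 2 by ring.
have -> : 1 - - z * y = 1 + z * y by ring.
by rewrite !mulf_neq0 ?P1_neq0 ?P2_neq0 ?P3_neq0 ?n4 ?n2 ?n1 ?zk1.
Qed.

Lemma coef_at_block (z : algC) d m r :
  odd d -> d.-primitive_root z -> (r < d)%N ->
  coef_at z (m * d + r) = coef_at z (m * d) * vwp_coef (- z) (- z) z r.
Proof.
move=> d_odd z_prim; elim: r => [|r IH] rd.
  by rewrite addn0 vwp_coef0 mulr1.
have zd1 := prim_expr_order z_prim.
have zS_neq1 : z ^+ (m * d + r).+1 != 1.
  by rewrite -(prim_order_dvd z_prim) -addnS dvdn_addr ?dvdn_mull // gtnNdvd.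
rewrite addnS (coef_atS d_odd zd1 zS_neq1) (IH (ltnW rd)) vwp_coefS -mulrA.
congr (_ * (_ * vwp_ratio _ _ _ _)).
by rewrite exprD mulrNN -expr2 -exprM mulnA mulnC exprM zd1 expr1n mul1r.
Qed.

(** The factor [coef_at z (m * d)] comes out of the block.  What is left is the
quadratic summation with a = z, b = c = -z, terminated by N = (d-1)/2. *)
Lemma block_sum_eq0 (z : algC) d m L : odd d -> d.-primitive_root z ->
  (d./2 < L <= d)%N ->
  \sum_(0 <= r < L)
    coef_at z (m * d + r) * (1 - z ^+ (6 * (m * d + r) + 1)) = 0.
Proof.
move=> d_odd z_prim /andP[dL Ld].
have zd1 := prim_expr_order z_prim.
case: L dL Ld => // M dM Md.
transitivity (coef_at z (m * d) * \sum_(0 <= r < M.+1)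
  (1 - z * ((- z * - z) ^+ r) ^+ 3) * vwp_coef (- z) (- z) z r).
  rewrite big_distrr /= !big_mkord; apply: eq_bigr => r _.
  rewrite (coef_at_block m d_odd z_prim (leq_trans (ltn_ord r) Md)).
  have -> : z ^+ (6 * (m * d + r) + 1) = z * ((- z * - z) ^+ r) ^+ 3.
    have -> : (6 * (m * d + r) + 1 = d * (6 * m) + (1 + 2 * r * 3))%N by lia.
    by rewrite exprD exprM zd1 expr1n mul1r exprD expr1 mulrNN -expr2
               -!exprM mulnA.
  by ring.
rewrite (@vwp_sum_eq0 _ _ _ _ d./2) ?mulr0 //.
- rewrite mulrNN -expr2 -exprM -exprS -[RHS]zd1; congr (_ ^+ _); lia.
- move=> j; suff -> : 1 - z * - z * (- z * - z) * (- z * - z) ^+ j ^+ 2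
                   = 1 + z ^+ (4 * j + 4) by split; apply: add1_root_neq0 zd1.
  by rewrite mulrNN -expr2 (exprAC z 2 j) exprD (mulnC 4 j) exprM; ring.
move=> j jM; rewrite mulrNN -expr2 -exprS -!exprM subr_eq0 eq_sym.
rewrite -(prim_order_dvd z_prim) mulnCA Gauss_dvdl.
  by rewrite gtnNdvd // (leq_trans _ Md).
by rewrite coprimeMr !coprimen2 d_odd.
Qed.

(** The last block may be empty or stop anywhere past the middle, which covers
both truncations. *)
Lemma blocks_sum_eq0 (z : algC) d m L : odd d -> d.-primitive_root z ->
  (L == 0)%N || (d./2 < L <= d)%N ->
  \sum_(0 <= k < m * d + L) coef_at z k * (1 - z ^+ (6 * k + 1)) = 0.
Proof.
move=> d_odd z_prim LP.
have full : \sum_(0 <= k < m * d) coef_at z k * (1 - z ^+ (6 * k + 1)) = 0.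
  elim: m => [|m IH]; first by rewrite big_geq.
  rewrite mulSn addnC (big_cat_nat (n := m * d)) ?leq_addr //= IH add0r.
  rewrite -{1}[(m * d)%N]add0n big_addn addKn.
  under eq_bigr do rewrite addnC.
  apply: block_sum_eq0; rewrite // leqnn andbT.
  by have := prim_order_gt0 z_prim; lia.
case/orP: LP => [/eqP -> | LP]; first by rewrite addn0.
rewrite (big_cat_nat (n := m * d)) ?leq_addr //= full add0r.
rewrite -{1}[(m * d)%N]add0n big_addn addKn.
by under eq_bigr do rewrite addnC; apply: block_sum_eq0.
Qed.

(** * Divisibility by the q-integer *)

(** Stated for a ring morphism to a field because it is applied twice: to the
embedding of Z[q] in Z(q), and to the evaluation at a root of unity. *)
Lemma rmorph_common_den (R : comNzRingType) (F : fieldType)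
  (f : {rmorphism R -> F}) (N D : nat -> R) m :
  (forall k, f (D k) != 0) ->
  f (\sum_(k < m) N k * \prod_(j < m | j != k) D j)
  = (\sum_(k < m) f (N k) / f (D k)) * f (\prod_(j < m) D j).
Proof.
move=> fD_neq0; rewrite rmorph_sum mulr_suml; apply: eq_bigr => k _.
by rewrite [in RHS](bigD1 k) //= !rmorphM mulrA divfK.
Qed.

Lemma qint_poly_poly m : qint_poly m.+1 = \poly_(i < m.+1) 1.
Proof.
by rewrite qint_polyE poly_def; apply: eq_bigr => i _; rewrite scale1r.
Qed.

Lemma qint_poly_monic m : qint_poly m.+1 \is monic.
Proof. by rewrite qint_poly_poly monicE lead_coef_poly. Qed.

(** The remainder by the monic polynomial [n], of degree n - 1, has degree less
than n - 1 and vanishes at the n - 1 nontrivial n-th roots of unity.  Dividing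
by a monic polynomial keeps the quotient in Z[q]. *)
Lemma Zdvd_qint n (A : {poly int}) : (0 < n)%N ->
  (forall z : algC, z ^+ n = 1 -> z != 1 -> evalC z A = 0) ->
  Zdvd (qint_poly n) A.
Proof.
case: n => // n _ A0; have monP := qint_poly_monic n.
have AE := Pdiv.RingMonic.rdivp_eq monP A.
exists (Pdiv.Ring.rdivp A (qint_poly n.+1)); rewrite {1}AE.
set r := Pdiv.Ring.rmodp _ _ in AE *.
suff -> : r = 0 by rewrite addr0.
have [w w_prim] := @C_prim_root_exists n.+1 isT.
apply: (map_inj_poly (@intr_inj algC) (rmorph0 _)); rewrite [RHS]rmorph0.
pose rs := [seq w ^+ i.+1 | i <- iota 0 n].
apply: (@roots_geq_poly_eq0 _ _ rs).
- apply/allP => x /mapP[i]; rewrite mem_iota add0n /= => i_lt -> {x}.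
  have zn1 : (w ^+ i.+1) ^+ n.+1 = 1.
    by rewrite exprAC (prim_expr_order w_prim) expr1n.
  have z_neq1 : w ^+ i.+1 != 1 by rewrite -(prim_order_dvd w_prim) gtnNdvd.
  have := A0 _ zn1 z_neq1; rewrite AE rmorphD rmorphM.
  have -> : evalC (w ^+ i.+1) (qint_poly n.+1) = 0.
    apply/eqP; have := evalC_qint (w ^+ i.+1) n.+1.
    rewrite zn1 subrr => /eqP; rewrite mulf_eq0 subr_eq0 eq_sym.
    by rewrite (negPf z_neq1).
  by rewrite mulr0 add0r => r0; apply/rootP.
- rewrite map_inj_in_uniq ?iota_uniq // => i j.
  rewrite !mem_iota !add0n /= => i_lt j_lt /eqP.
  rewrite (eq_prim_root_expr w_prim) !modn_small //; first by move/eqP; case.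
rewrite size_map size_iota
  (size_map_inj_poly (@intr_inj algC) (rmorph0 _)) // -ltnS.
have := Pdiv.Ring.ltn_rmodp A (qint_poly n.+1).
by rewrite (monic_neq0 monP) -/r qint_poly_poly size_poly_eq ?oner_neq0.
Qed.

(** A common divisor has a leading coefficient +-1, as it divides a monic
polynomial; if it were not constant it would have a complex root, an n-th root
of unity. *)
Lemma Zcoprime_qint n (B : {poly int}) : (0 < n)%N ->
  (forall z : algC, z ^+ n = 1 -> evalC z B != 0) -> Zcoprime (qint_poly n) B.
Proof.
case: n => // n _ B_neq0 D [C eqC] [E eqE].
have lcD : lead_coef D \is a GRing.unit.
  apply/unitrPr; exists (lead_coef C).
  by rewrite mulrC -lead_coefM -eqC (eqP (qint_poly_monic n)).
rewrite poly_unitE.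
have [sz1|sz_neq1] := eqVneq (size D) 1%N.
  by move: lcD; rewrite lead_coefE sz1.
have /closed_rootP[z /rootP Dz] : size (map_poly (intr : int -> algC) D) != 1%N.
  by rewrite (size_map_inj_poly (@intr_inj algC) (rmorph0 _)).
have {}Dz : evalC z D = 0 by [].
have zn1 : z ^+ n.+1 = 1.
  apply/eqP; rewrite eq_sym -subr_eq0 -evalC_qint eqC.
  by rewrite rmorphM Dz !mulr0.
by have := B_neq0 z zn1; rewrite eqE rmorphM Dz mulr0 eqxx.
Qed.

Lemma qterm_sum_qcongr n m : odd n ->
  (forall z : algC, z ^+ n = 1 -> z != 1 ->
     \sum_(0 <= k < m) coef_at z k * (1 - z ^+ (6 * k + 1)) = 0) ->
  qcongr (\sum_(0 <= k < m) qterm k) 0 (qint_poly n).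
Proof.
move=> n_odd sum0; have n_gt0 := odd_gt0 n_odd.
pose N k := coef_num k * qint_poly (6 * k + 1).
pose A2 := \prod_(j < m) coef_den j.
pose A1 := \sum_(k < m) N k * \prod_(j < m | j != k) coef_den j.
have A2_neq0 : A2 != 0 by apply/prodf_neq0 => j _; apply: coef_den_neq0.
exists A1, A2; split=> //.
- rewrite subr0; apply: (canRL (mulfK _)); first by rewrite tofrac_eq0.
  rewrite big_mkord; under eq_bigr do rewrite qterm_frac.
  pose f : {rmorphism {poly int} -> Zq} := @tofrac {poly int}.
  rewrite -[RHS]/(f A1) (@rmorph_common_den _ _ f N coef_den) // => k.
  by rewrite /f tofrac_eq0 coef_den_neq0.
- apply: Zdvd_qint => // z zn1 z_neq1.
  rewrite /A1 rmorph_common_den;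
    last exact: (fun k => evalC_coef_den_neq0 k n_odd zn1).
  suff -> : \sum_(k < m) evalC z (N k) / evalC z (coef_den k) = 0
    by rewrite mul0r.
  have z1_neq0 : 1 - z != 0 by rewrite subr_eq0 eq_sym.
  apply: (mulfI z1_neq0); rewrite mulr0 -[RHS](sum0 z zn1 z_neq1).
  rewrite mulr_sumr big_mkord.
  apply: eq_bigr => k _; rewrite -evalC_qint /coef_at rmorphM; ring.
apply: Zcoprime_qint => // z zn1; rewrite rmorph_prod.
by apply/prodf_neq0 => j _; apply: evalC_coef_den_neq0 zn1.
Qed.

Theorem theorem1p2 (n : nat) (n_gt0 : (0 < n)%N) (n_odd : odd n) :
  qcongr (\sum_(0 <= k < n) qterm k) 0 (qint_poly n) /\
  qcongr (\sum_(0 <= k < ((n - 1) %/ 2).+1) qterm k) 0 (qint_poly n).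
Proof.
split; apply: qterm_sum_qcongr => // z zn1 z_neq1;
  have [d z_prim /dvdnP[e n_eq]] := prim_order_exists n_gt0 zn1;
  have /andP[e_odd d_odd] : odd e && odd d by rewrite -oddM -n_eq.
  by rewrite n_eq -[(e * d)%N]addn0; apply: blocks_sum_eq0.
have -> : ((n - 1) %/ 2).+1 = (e./2 * d + d./2.+1)%N by nia.
apply: blocks_sum_eq0 => //; rewrite ltnSn /=.
have d_gt0 := prim_order_gt0 z_prim.
have d_neq1 : d != 1%N.
  apply: contra_neq z_neq1 => d1; rewrite d1 in z_prim.
  by rewrite -(prim_expr_order z_prim).
lia.
Qed.
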